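(* Let $n\ge 2$ be an integer and let $p(z)$ be a complex polynomial of degree $n$. Suppose that a closed disk $D\subset\mathbb{C}$ contains $n-1$ zeros of $p$ (counted with multiplicity), that is, the zeros of $p$, listed with multiplicity, can be written as $z_1,\ldots,z_n$ with $z_1,\ldots,z_{n-1}\in D$, and suppose that the centre of $D$ is the arithmetic mean $\frac{1}{n-1}\sum_{j=1}^{n-1}z_j$ of these zeros. Then for every positive integer $k$ the disk $D$ contains at least $\left[\frac{n-2k+1}{2}\right]$ zeros, counted with multiplicity, of the $k$-th derivative $p^{(k)}(z)$.
   Context: $[x]$ denotes the integer part of the real number $x$. (When $\left[\frac{n-2k+1}{2}\right]\le 0$ the conclusion is vacuous.) *)

(* Defs.v *)
(* The complex numbers are R[i], for R a complete archimedean ordered field. *)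
From mathcomp Require Import all_boot all_order all_algebra.
From mathcomp Require Import reals.
From mathcomp Require Import complex.

Set Implicit Arguments.
Unset Strict Implicit.
Unset Printing Implicit Defensive.

Import Order.TTheory GRing.Theory Num.Theory.
Local Open Scope ring_scope.
Local Open Scope complex_scope.

(* `|z - c| is a (real) element of R[i], hence the injection of r. *)
Definition closed_disk (R : realType) (c : R[i]) (r : R) : pred R[i] :=
  [pred z : R[i] | `|z - c| <= r%:C :> R[i]].

(* The bound m is an integer: the property holds trivially (with s empty) when
   m <= 0, in particular when q = 0 is the derivative of an order exceeding
   the degree. *)
Definition has_at_least_zeros_in (R : realType) (q : {poly R[i]})
    (D : pred R[i]) (m : int) : Prop :=
  exists s : seq R[i],
    [/\ uniq s, all D s & m <= (\sum_(x <- s) mup x q)%N%:Z].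

(* Main.v *)
(* Put the centre of D at 0, write p = (X - a) q and M = n - k. If y is a zero of
   p^(k) outside D, then (y - a) Q'(y) + k Q(y) = 0 with Q = q^(k-1), whose M zeros
   lie in D by Gauss-Lucas; since Q'(y) / Q(y) = M / (y - w) for some w in D, y is
   within k r / n of t = M a / n. On the other hand the zeros of p^(k) have sum t,
   so after rotating a onto the positive axis and projecting, the N zeros outside D
   have real part at least some X and the others at least - r, which gives
   N (X + r) <= t + M r and forces 2 N <= n. *)
Require Import Defs.
From mathcomp Require Import all_boot all_order all_algebra.
From mathcomp Require Import reals.
From mathcomp Require Import complex.
From mathcomp Require Import ring lra zify.

Import Order.TTheory GRing.Theory Num.Theory.
Local Open Scope ring_scope.

Set Implicit Arguments.
Unset Strict Implicit.
Unset Printing Implicit Defensive.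

(** * Iterated and logarithmic derivatives of polynomials *)

Lemma size_derivn_char0 (F : numDomainType) (q : {poly F}) k :
  size q^`(k) = (size q - k)%N.
Proof.
have [qk|kq] := leqP (size q) k.
  by rewrite derivn_poly0 // size_poly0; apply/esym/eqP.
apply/eqP; rewrite eqn_leq; apply/andP; split.
  apply/leq_sizeP => j; rewrite leq_subLR => qj.
  by rewrite coef_derivn nth_default // mul0rn.
have e : (k + (size q - k).-1 = (size q).-1)%N by lia.
rewrite -(prednK (_ : 0 < size q - k)%N) ?subn_gt0 // ltnNge.
apply/negP => /leq_sizeP/(_ _ (leqnn _)); rewrite coef_derivn e => /eqP.
rewrite mulrn_eq0 -lead_coefE lead_coef_eq0 -size_poly_eq0 -leqn0 leqNgt.
rewrite ffact_gt0 -leqn0 => /orP[|]; lia.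
Qed.

Lemma derivn_mul_XsubC (F : comNzRingType) (q : {poly F}) (a : F) k :
  (('X - a%:P) * q)^`(k.+1) = ('X - a%:P) * q^`(k.+1) + q^`(k) *+ k.+1.
Proof.
elim: k => [|k IH]; first by rewrite !derivn1 derivM derivXsubC mul1r addrC.
rewrite derivnS IH derivD derivM derivXsubC mul1r derivMn -!derivnS.
by rewrite addrAC -mulrS addrC.
Qed.

Lemma deriv_prod_XsubC (C : fieldType) (s : seq C) (y : C) : y \notin s ->
  (\prod_(x <- s) ('X - x%:P))^`().[y] =
  (\prod_(x <- s) ('X - x%:P)).[y] * \sum_(x <- s) (y - x)^-1.
Proof.
elim: s => [|x s IH]; first by rewrite !big_nil derivC hornerC mulr0.
rewrite in_cons negb_or => /andP[yx /IH e].
rewrite !big_cons derivM derivXsubC hornerD !hornerM e hornerXsubC hornerC.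
by field; rewrite subr_eq0.
Qed.

(** * Zeros of derivatives relative to a disk *)

Section Disk.
Variables (C : numClosedFieldType) (r : C).
Hypothesis r_ge0 : 0 <= r.

(* The inversion [x |-> (y - x)^-1] maps the disk [|x| <= r] into the disk
   [|D v - y^*| <= r] where [D = |y|^2 - r^2]. *)
Lemma norm_inv_disk (x y : C) : r < `|y| -> `|x| <= r ->
  `|(`|y| ^+ 2 - r ^+ 2) * (y - x)^-1 - y^*| <= r.
Proof.
move=> ry xr; have rr : r^* = r by apply/CrealP/ger0_real.
have yx : y - x != 0.
  by apply/negP => /eqP/subr0_eq e; move: (le_lt_trans xr ry); rewrite e ltxx.
rewrite (_ : _ - y^* = (y^* * x - r ^+ 2) / (y - x)); last first.
  by rewrite normCK; field.
rewrite normrM normfV ler_pdivrMr ?normr_gt0 //.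
rewrite -(@ler_pXn2r _ 2) ?nnegrE ?mulr_ge0 // exprMn -subr_le0.
rewrite !normCK !(rmorphB, rmorphM, rmorphXn) /= conjCK rr.
(* After squaring, [|y^* x - r^2|^2 - r^2 |y - x|^2] factors, with a positive first factor and a
   nonpositive second one. *)
rewrite (_ : _ - _ = (`|y| ^+ 2 - r ^+ 2) * (`|x| ^+ 2 - r ^+ 2)).
  rewrite mulr_ge0_le0 ?subr_ge0 ?subr_le0 ?ler_pXn2r ?nnegrE // ltW //.
by rewrite !normCK; ring.
Qed.

(** By convexity the mean of the inverted points stays in the image disk; inverting back gives the
    bound. If the sum [S] is nonzero, it says [S = m / (y - w)] with [|w| <= r], where [m] is the
    size of [s]; the form without division also covers [S = 0]. *)
Lemma norm_sum_inv_disk (s : seq C) (y : C) : r < `|y| ->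
    (forall x, x \in s -> `|x| <= r) ->
  `|y * \sum_(x <- s) (y - x)^-1 - (size s)%:R| <= r * `|\sum_(x <- s) (y - x)^-1|.
Proof.
move=> ry sr; have rr : r^* = r by apply/CrealP/ger0_real.
set S := \sum_(x <- s) _; set D := `|y| ^+ 2 - r ^+ 2.
have D_gt0 : 0 < D by rewrite subr_gt0 ltr_pXn2r ?nnegrE.
have Sle : `|D * S - (size s)%:R * y^*| <= (size s)%:R * r.
  rewrite /S mulr_sumr.
  have -> : (size s)%:R * y^* = \sum_(x <- s) y^*.
    by rewrite big_const_seq count_predT iter_addr_0 mulr_natl.
  have -> : (size s)%:R * r = \sum_(x <- s) r.
    by rewrite big_const_seq count_predT iter_addr_0 mulr_natl.
  rewrite -sumrB; apply: le_trans (ler_norm_sum _ _ _) _.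
  rewrite big_seq [leRHS]big_seq; apply: ler_sum => x xs.
  exact/norm_inv_disk/sr.
(* Since [D (|y S - m|^2 - r^2 |S|^2) = |D S - m y^*|^2 - m^2 r^2], the squared goal times [D > 0]
   is the squared [Sle]. *)
rewrite -(@ler_pXn2r _ 2) ?nnegrE ?mulr_ge0 // -subr_le0 -(pmulr_rle0 _ D_gt0).
rewrite -(@ler_pXn2r _ 2) ?nnegrE ?mulr_ge0 // -subr_le0 in Sle.
have tr (a b : C) : a = b -> a <= 0 -> b <= 0 by move=> ->.
apply: (tr _ _ _ Sle); rewrite [in RHS]exprMn /D !normCK.
rewrite !(rmorphB, rmorphM, rmorphXn) /= !conjC_nat !conjCK rr.
ring.
Qed.

(** [S] is the logarithmic derivative of [q] at [y], that is, the sum of [(y - x)^-1] over the zeros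
    [x]; a translation by [c] reduces to a disk centred at 0. *)
Lemma horner_deriv_disk (q : {poly C}) (c y : C) : q != 0 ->
    (forall x, root q x -> `|x - c| <= r) -> r < `|y - c| -> q.[y] != 0 /\
  exists2 S, q^`().[y] = q.[y] * S &
    `|(y - c) * S - (size q).-1%:R| <= r * `|S|.
Proof.
move=> q0 qr ry.
have qy : q.[y] != 0.
  by apply/negP => /qr /(lt_le_trans ry); rewrite ltxx.
split=> //; have [s qE] := closed_field_poly_normal q.
have l0 : lead_coef q != 0 by rewrite lead_coef_eq0.
have rootE x : root q x = (x \in s) by rewrite qE rootZ // root_prod_XsubC.
have ys : y \notin s by rewrite -rootE.
have szq : (size q).-1 = size s.
  by rewrite qE size_scale // size_prod_XsubC.
exists (\sum_(x <- s) (y - x)^-1).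
  by rewrite {1 2}qE derivZ !hornerZ deriv_prod_XsubC // mulrA.
have := @norm_sum_inv_disk [seq x - c | x <- s] (y - c) ry.
rewrite size_map -szq big_map.
under eq_bigr do rewrite opprB addrA subrK.
by apply=> _ /mapP[x xs ->]; apply: qr; rewrite rootE.
Qed.

(** At a zero of [q'] outside the disk the logarithmic derivative would vanish, and the bound with
    [S = 0] would force degree 0. *)
Lemma Gauss_Lucas_disk (q : {poly C}) (c : C) : (1 < size q)%N ->
    (forall x, root q x -> `|x - c| <= r) ->
  forall y, root q^`() y -> `|y - c| <= r.
Proof.
move=> q1 qr y /rootP q'y; have q0 : q != 0 by rewrite -size_poly_gt0 ltnW.
rewrite real_leNgt ?ger0_real //; apply/negP => ry.
have [qy [S SE]] := horner_deriv_disk q0 qr ry.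
have S0 : S = 0 by apply/eqP; move/eqP: SE; rewrite q'y eq_sym mulf_eq0 (negPf qy).
rewrite S0 mulr0 sub0r normrN normr0 mulr0 normr_le0 pnatr_eq0.
by case: (size q) q1 => [|[]].
Qed.

Lemma Gauss_Lucas_derivn_disk (q : {poly C}) (c : C) k : (k < size q)%N ->
    (forall x, root q x -> `|x - c| <= r) ->
  forall y, root q^`(k) y -> `|y - c| <= r.
Proof.
elim: k => // k IH kq qr; rewrite derivnS; apply: Gauss_Lucas_disk.
  by rewrite size_derivn_char0 ltn_subRL addn1.
exact: IH (ltnW kq) qr.
Qed.

Lemma norm_root_derivn (q : {poly C}) (a c y : C) k : (k < size q)%N ->
    (forall x, root q x -> `|x - c| <= r) -> r < `|y - c| ->
    root (('X - a%:P) * q)^`(k.+1) y ->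
  `|(size q)%:R * (y - c) - (size q - k.+1)%:R * (a - c)| <= k.+1%:R * r.
Proof.
move=> kq qr ry; rewrite derivn_mul_XsubC => /rootP e.
have qk0 : q^`(k) != 0 by rewrite -size_poly_gt0 size_derivn_char0 subn_gt0.
have [] := horner_deriv_disk qk0 (Gauss_Lucas_derivn_disk kq qr) ry.
rewrite -derivnS size_derivn_char0 -subnS => qy [S qS SE].
rewrite hornerD hornerM hornerMn hornerXsubC qS in e.
have {}e : (y - a) * S = - k.+1%:R.
  by apply: (mulfI qy); rewrite mulrN mulr_natr -[RHS]add0r -e; ring.
have k0 : 0 <= k.+1%:R :> C by [].
have -> : (size q)%:R * (y - c) - (size q - k.+1)%:R * (a - c) =
    - ((y - a) * ((y - c) * S - (size q - k.+1)%:R)).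
  by rewrite [(y - a) * _]mulrBr [(y - a) * _]mulrCA e -{1}(subnK kq) natrD; ring.
rewrite normrN normrM -(ger0_norm k0) -[k.+1%:R]opprK -e normrN normrM.
by rewrite -mulrA [_ * r]mulrC ler_wpM2l.
Qed.

End Disk.

(** * Two ingredients of the count: the sum of the zeros and a bound in the real plane *)

(** Differentiation preserves the mean of the zeros, as comparing the two top coefficients shows. *)
Lemma sum_roots_derivn (C : numClosedFieldType) (l l' : C) (s t : seq C) k :
    l != 0 -> (k < size s)%N ->
    (l *: \prod_(x <- s) ('X - x%:P))^`(k) = l' *: \prod_(x <- t) ('X - x%:P) ->
  (size s)%:R * \sum_(x <- t) x = (size s - k)%:R * \sum_(x <- s) x.
Proof.
set p := l *: _; set n := size s => l0 kn pk.
have n0 : n != 0%N by lia.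
have sp : size p = n.+1 by rewrite size_scale // size_prod_XsubC.
have l'0 : l' != 0.
  apply/eqP => l'0; move/(congr1 (fun q : {poly C} => size q)): pk.
  by rewrite /= l'0 scale0r size_poly0 size_derivn_char0 sp; lia.
have st : size t = (n - k)%N.
  move/(congr1 (fun q : {poly C} => size q)): pk.
  by rewrite /= size_derivn_char0 sp size_scale // size_prod_XsubC; lia.
have pn : p`_n = l.
  rewrite coefZ; have /monicP := monic_prod_XsubC s predT id.
  by rewrite lead_coefE size_prod_XsubC /= => ->; rewrite mulr1.
have pn1 : p`_n.-1 = - (l * \sum_(x <- s) x).
  by rewrite coefZ coefPn_prod_XsubC // mulrN.
have e1 : l *+ n ^_ k = l'.
  have := congr1 (fun q : {poly C} => q`_(n - k)) pk.
  rewrite /= coef_derivn subnKC 1?ltnW // pn coefZ => ->.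
  have /monicP := monic_prod_XsubC t predT id.
  by rewrite lead_coefE size_prod_XsubC /= st => ->; rewrite mulr1.
have e2 : (l * \sum_(x <- s) x) *+ n.-1 ^_ k = l' * \sum_(x <- t) x.
  have := congr1 (fun q : {poly C} => q`_(n - k).-1) pk.
  rewrite /= coef_derivn (_ : (k + _)%N = n.-1); last by lia.
  rewrite pn1 coefZ -st coefPn_prod_XsubC ?st; last by lia.
  by rewrite mulNrn mulrN => /oppr_inj.
(* The two coefficients acquire the factors [n ^_ k] and [n.-1 ^_ k], whose ratio is
   [n / (n - k)]. *)
have f : (n ^_ k * (n - k) = n * n.-1 ^_ k)%N by rewrite -ffactnSr ffactnS.
apply: (mulfI l'0); rewrite mulrCA -e2 -e1.
have {}f : (n ^_ k)%:R * (n - k)%:R = n%:R * (n.-1 ^_ k)%:R :> C.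
  by rewrite -!natrM f.
rewrite -(mulr_natr l) -(mulr_natr (_ * _)) mulrCA -f.
by ring.
Qed.

(* [X] is the leftmost abscissa [t - w] of the disk of centre [t] and radius [w] if
   that disk is disjoint from the open disk of centre [0] and radius [r], and the
   abscissa of the intersection points of the two circles otherwise. *)
Lemma lune_abscissa (R : realFieldType) (n k r t w : R) :
    2 <= n -> 1 <= k -> k < n -> 0 <= r -> 0 <= t -> n * w = k * r ->
    r < t + w ->
  exists X, [/\ 0 < X + r, 2 * (t + (n - k) * r) < (n + 1) * (X + r) &
    forall u v, r ^+ 2 < u ^+ 2 + v ^+ 2 -> (u - t) ^+ 2 + v ^+ 2 <= w ^+ 2 ->
      X <= u].
Proof.
move=> n2 k1 kn r0 t0 nw rtw.
have n0 : 0 < n by lra.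
have w0 : 0 <= w by rewrite -(pmulr_rge0 _ n0) nw mulr_ge0 //; lra.
have wr : w <= r by rewrite -(ler_pM2l n0) nw ler_wpM2r // ltW.
have [rwt|trw] := leP (r + w) t.
  exists (t - w); split.
  - nra.
  (* Because [n w = k r], the two sides of the goal differ by exactly this product. *)
  - have : 0 < (n - 1) * (t + w - r) by apply: mulr_gt0; lra.
    nra.
  - move=> u v _ h; have {}h : (u - t) ^+ 2 <= w ^+ 2 by nra.
    by rewrite leNgt; apply/negP => h'; nra.
have rp : 0 < r by nra.
have {}wr : w < r by nra.
have tp : 0 < t by nra.
(* The radical axis of the two circles: subtracting the two conditions on [(u, v)] cancels the
   squares and leaves a linear bound on [u]. *)
exists ((r ^+ 2 + t ^+ 2 - w ^+ 2) / (2 * t)).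
have e : (r ^+ 2 + t ^+ 2 - w ^+ 2) / (2 * t) + r
    = ((r + t) ^+ 2 - w ^+ 2) / (2 * t) by field; lra.
split.
- by rewrite e divr_gt0 //; nra.
- rewrite e mulrA ltr_pdivlMr; last by lra.
  rewrite mulrBl -nw.
  (* With [d = t - r], the right side minus the left one is [4 t (n w - d) + (n + 1) (d - w) x].
     Replacing [t] by the smaller [x] ([h3]) leaves [x ((3 n - 1) w + (n - 3) d)], nonnegative by
     [h1]. *)
  set x := t + w - r.
  have x0 : 0 < x by rewrite /x; lra.
  have tx : x < t by rewrite /x; lra.
  have h1 : 0 <= (3 * n - 1) * w + (n - 3) * (t - r) by nra.
  have h2 : 0 < n * w - (t - r) by nra.
  have h3 : x * (4 * (n * w - (t - r))) < t * (4 * (n * w - (t - r))).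
    by rewrite ltr_pM2r //; lra.
  rewrite /x in h3; nra.
- move=> u v h1 h2; rewrite ler_pdivrMr; last by lra.
  nra.
Qed.

Local Open Scope complex_scope.

(** * Counting the zeros outside the disk *)

Section Count.
Variable R : rcfType.

(** To be applied to the zeros of the derivative once the centre is moved to 0 and the exceptional
    zero is rotated to the real number [A]. *)
Lemma count_outside_disk (s : seq R[i]) (n k : nat) (r A : R) :
    (2 <= n)%N -> (0 < k < n)%N -> 0 <= r -> 0 <= A -> size s = (n - k)%N ->
    n%:R * \sum_(x <- s) x = (n - k)%:R * A%:C ->
    (forall x, x \in s -> r%:C < `|x| ->
       `|n%:R * x - (n - k)%:R * A%:C| <= k%:R * r%:C) ->
  ((count (fun x => (r%:C < `|x|)%R) s).*2 <= n)%N.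
Proof.
move=> n2 /andP[k0 kn] r0 A0 ss sumE out; rewrite leqNgt; apply/negP => nN.
set P := fun x : R[i] => _ in nN.
have n0 : 0 < n%:R :> R by rewrite ltr0n; lia.
pose t : R := (n - k)%:R * A / n%:R; pose w : R := k%:R * r / n%:R.
have t0 : 0 <= t by rewrite divr_ge0 // ?mulr_ge0 // ltW.
have w0 : 0 <= w by rewrite divr_ge0 // ?mulr_ge0 // ltW.
have rC0 : 0 <= r%:C by rewrite ler0c.
have wC0 : 0 <= w%:C by rewrite ler0c.
have nC0 : n%:R != 0 :> R[i] by rewrite pnatr_eq0; lia.
have tE : n%:R * t%:C = (n - k)%:R * A%:C.
  by rewrite -!(rmorph_nat (real_complex R)) -!rmorphM /= /t mulrC divfK ?gt_eqF.
have wE : n%:R * w%:C = k%:R * r%:C.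
  by rewrite -!(rmorph_nat (real_complex R)) -!rmorphM /= /w mulrC divfK ?gt_eqF.
have PE x : P x = (r ^+ 2 < complex.Re x ^+ 2 + complex.Im x ^+ 2).
  rewrite /P -(@ltr_pXn2r R[i] 2) ?nnegrE ?rC0 ?wC0 // -add_Re2_Im2.
  by rewrite -rmorphXn /= ltcR.
have outw x : x \in s -> P x ->
    (complex.Re x - t) ^+ 2 + complex.Im x ^+ 2 <= w ^+ 2.
  move=> xs /(out x xs).
  rewrite -tE -mulrBr normrM normr_nat -wE ler_pM2l ?ltr0n; last by lia.
  rewrite -(@ler_pXn2r R[i] 2) ?nnegrE ?rC0 ?wC0 // -add_Re2_Im2 -rmorphXn /= lecR.
  by case: x {xs} => a b /=; rewrite subr0.
(* The negated claim provides a point outside the disk; it lies within [w] of [t], hence within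
   [t + w] of 0, so [r < t + w]. *)
have /hasP[x0 x0s Px0] : has P s by rewrite has_count; case: (count P s) nN.
have rtw : r < t + w.
  have := outw _ x0s Px0; have := Px0; rewrite PE.
  set u := complex.Re _; set v := complex.Im _ => h1 h2.
  have h3 : u <= t + w.
    by rewrite leNgt; apply/negP => h3; nra.
  by rewrite ltNge; apply/negP => h4; nra.
have [||||X [X0 Xn XP]] := @lune_abscissa R n%:R k%:R r t w _ _ _ r0 t0 _ rtw.
- by rewrite ler_nat.
- by rewrite ler1n.
- by rewrite ltr_nat.
- by rewrite /w mulrCA divff ?mulr1 // gt_eqF.
have sumRe : \sum_(x <- s) complex.Re x = t.
  have /(congr1 (@complex.Re R)) /= <- : \sum_(x <- s) x = t%:C.
    by apply: (mulfI nC0); rewrite sumE tE.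
  by rewrite raddf_sum.
(* Points outside have real part at least [X], the others at least [- r]. *)
have lb : \sum_(x <- s) (if P x then X + r else 0) <= \sum_(x <- s) (complex.Re x + r).
  rewrite big_seq [leRHS]big_seq; apply: ler_sum => x xs.
  case: ifPn => Px; first by rewrite lerD2r; apply: XP (outw _ xs Px); rewrite -PE.
  rewrite PE -leNgt in Px; rewrite leNgt; apply/negP => h.
  nra.
rewrite -big_mkcond big_const_seq iter_addr_0 big_split /= sumRe in lb.
rewrite big_const_seq count_predT iter_addr_0 ss in lb.
rewrite -[_ *+ (n - k)]mulr_natl natrB ?(ltnW kn) // in lb.
rewrite -mulr_natl in lb.
(* Now [lb] bounds [N (X + r)] by [t + (n - k) r], so [Xn] yields [2 N < n + 1]. *)
set N : R := (count P s)%:R in lb.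
have {}nN : n%:R + 1 <= 2 * N by rewrite natr1 -natrM ler_nat mul2n.
nra.
Qed.
End Count.

(** * From the count to the theorem *)

Lemma has_at_least_zeros_prod (R : realType) (l : R[i]) (s : seq R[i])
    (D : pred R[i]) (m : int) : l != 0 -> m <= (count D s)%:Z ->
  has_at_least_zeros_in (l *: \prod_(x <- s) ('X - x%:P)) D m.
Proof.
move=> l0 mD; exists (undup (filter D s)); split.
- exact: undup_uniq.
- by apply/allP => x; rewrite mem_undup mem_filter => /andP[].
apply: le_trans mD _; rewrite lez_nat.
(* The size of the filtered list is the sum, over its distinct elements, of their numbers of
   occurrences, which are root multiplicities. *)
rewrite -size_filter -sum1_size -big_undup_iterop_count /= big_seq [leqRHS]big_seq.
apply: leq_sum => x; rewrite mem_undup mem_filter => /andP[Dx _].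
rewrite -mul_polyC mupMr; last by rewrite rootC.
rewrite mu_prod_XsubC count_filter Monoid.iteropE.
rewrite iter_addn_0 mul1n; apply: eq_leq; apply: eq_count => y /=.
by case: eqVneq => // ->; rewrite Dx.
Qed.

(** With [M] zeros inside and [N] outside, [2 M = 2 n - 2 k - 2 N >= n - 2 k], so the number under
    the floor is at most [M + 1/2]. *)
Lemma floor_half_le (R : realType) (n k N M : nat) :
  (M + N + k = n)%N -> (N.*2 <= n)%N ->
  Num.floor ((n%:R - 2%:R * k%:R + 1) / 2%:R : R) <= M%:Z.
Proof.
move=> nE Nn; rewrite -ltzD1 -(ltr_int R); apply: le_lt_trans (floor_le _) _.
rewrite ltr_pdivrMr // intrD -nE !natrD.
move: Nn; rewrite -(ler_nat R) -nE -mul2n natrM !natrD => Nn.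
by rewrite /=; lra.
Qed.

Lemma unit_direction (C : numClosedFieldType) (a : C) :
  exists2 e : C, `|e| = 1 & a * e = `|a|.
Proof.
have [->|a0] := eqVneq a 0; first by exists 1; rewrite ?normr1 // mulr1 normr0.
have na0 : `|a| != 0 by rewrite normr_eq0.
exists (`|a| / a); first by rewrite normrM normfV normr_id divff.
by rewrite mulrC divfK.
Qed.

Theorem theorem2 (R : realType) (n : nat) (p : {poly R[i]}) (z : 'I_n -> R[i])
    (c : R[i]) (r : R) (k : nat)
    (n_ge2 : (2 <= n)%N)
    (deg_p : size p = n.+1)
    (zeros_p : p = lead_coef p *: \prod_(j < n) ('X - (z j)%:P))
    (r_ge0 : 0 <= r)
    (z_in_disk : forall j : 'I_n, (j < n.-1)%N -> z j \in closed_disk c r)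
    (c_mean : c = (\sum_(j < n | (j < n.-1)%N) z j) / (n.-1)%:R)
    (k_gt0 : (0 < k)%N) :
  has_at_least_zeros_in p^`(k) (closed_disk c r)
    (Num.floor ((n%:R - 2%:R * k%:R + 1) / 2%:R : R)).
Proof.
(* For [k >= n] the bound is not positive, and the empty list suffices. *)
have [nk|kn] := leqP n k.
  exists [::]; split=> //; rewrite big_nil floor_le0 ltr_pdivrMr //.
  by move: nk n_ge2; rewrite -!(ler_nat R); lra.
case: n => [//|m] in z n_ge2 deg_p zeros_p z_in_disk c_mean kn *.
rewrite /= in n_ge2 z_in_disk c_mean.
set l := lead_coef p in zeros_p; set a := z ord_max.
have l0 : l != 0 by rewrite lead_coef_eq0 -size_poly_eq0 deg_p.
pose zs := [seq z (widen_ord (leqnSn m) j) | j <- enum 'I_m].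
have szs : size zs = m by rewrite size_map size_enum_ord.
pose q := \prod_(x <- zs) ('X - x%:P).
have zsE x : x \in zs -> `|x - c| <= r%:C.
  by case/mapP => j _ ->; apply: z_in_disk => /=.
(* Relative to [c] the zeros in [zs] sum to 0, so the sum of all the zeros of [p] relative to [c] is
   [a - c]. *)
have sumzs : \sum_(x <- zs) x = m%:R * c.
  rewrite c_mean mulrC divfK ?pnatr_eq0; last by lia.
  rewrite [RHS]big_mkcond big_ord_recr /= ltnn addr0 big_map big_enum.
  by apply: eq_bigr => j _; rewrite /= ltn_ord.
have pE : p = l *: \prod_(x <- rcons zs a) ('X - x%:P).
  by rewrite zeros_p big_rcons /= big_map big_enum /= big_ord_recr.
have [s pkE] := closed_field_poly_normal p^`(k).
set l' := lead_coef _ in pkE.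
have l'0 : l' != 0.
  by rewrite lead_coef_eq0 -size_poly_eq0 size_derivn_char0 deg_p; lia.
have ss : size s = (m.+1 - k)%N.
  have : size p^`(k) = (size s).+1.
    by rewrite pkE size_scale // size_prod_XsubC.
  by rewrite size_derivn_char0 deg_p; lia.
have sumE : m.+1%:R * \sum_(x <- s) x = (m.+1 - k)%:R * (m%:R * c + a).
  have := @sum_roots_derivn _ l l' (rcons zs a) s k l0.
  have -> : \sum_(x <- rcons zs a) x = m%:R * c + a by rewrite big_rcons /= sumzs.
  by rewrite size_rcons szs => -> //; rewrite -pE.
have out y : y \in s -> r%:C < `|y - c| ->
    `|m.+1%:R * (y - c) - (m.+1 - k)%:R * (a - c)| <= k%:R * r%:C.
  (* [norm_root_derivn] treats the derivative of order [k.+1], hence the instance [k.-1]. *)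
  move=> ys ry; have := @norm_root_derivn _ r%:C _ q a c y k.-1.
  rewrite size_prod_XsubC szs prednK // ler0c; apply=> //.
  - by lia.
  - by move=> x; rewrite root_prod_XsubC => /zsE.
  have : root p^`(k) y by rewrite pkE rootZ // root_prod_XsubC.
  by rewrite pE big_rcons /= mulrC derivnZ rootZ.
have [e e1 ae] := unit_direction (a - c).
pose A := complex.Re `|a - c|.
have AE : A%:C = `|a - c| by rewrite RRe_real ?normr_real.
have A0 : 0 <= A by rewrite -ler0c AE.
have norme x : `|x * e| = `|x| by rewrite normrM e1 mulr1.
(* Translating by [- c] and rotating by [e] sends [a] to [A] and turns distances to [c] into
   moduli. *)
have := @count_outside_disk R [seq (x - c) * e | x <- s] m.+1 k r A.
rewrite size_map k_gt0 kn => /(_ n_ge2 isT r_ge0 A0 ss).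
rewrite big_map count_map -mulr_suml sumrB big_const_seq count_predT iter_addr_0 ss.
rewrite AE -ae => H.
rewrite pkE; apply: has_at_least_zeros_prod => //.
apply: (@floor_half_le R m.+1 k (count (predC (closed_disk c r)) s)).
  by rewrite count_predC ss subnK // ltnW.
rewrite (@eq_count _ _ (fun x => r%:C < `|x - c|)); last first.
  by move=> x /=; rewrite real_ltNge ?normr_real ?ger0_real ?ler0c.
move: H; rewrite (@eq_count _ (preim _ _) (fun x => r%:C < `|x - c|)); last first.
  by move=> x /=; rewrite norme.
apply.
  rewrite !mulrA; congr (_ * e); rewrite mulrBr sumE -mulr_natr -natr1; ring.
move=> _ /mapP[x xs ->]; rewrite norme => /(out _ xs).
by rewrite !mulrA -mulrBl norme.
Qed.
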